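(* Let $G$ be a bipartite simple graph with vertex set $[n]=\{1,\dots,n\}$ and without isolated vertices, let $S=k[x_1,\dots,x_n]$ be the polynomial ring over a field $k$, and let $\{i,j\}$ be an edge of $G$. Denote by $P$ both the edge $\{i,j\}$ and the prime ideal $(x_i,x_j)$ of $S$. Then for all integers $t\ge 1$, $$v_P\bigl(J(G)^{(t)}\bigr)=v_P\bigl(J(G)\bigr)+(t-1)\,\gamma_{1,P}.$$
   Context: $S=k[x_1,\dots,x_n]$ is standard graded and $S_d$ denotes its degree-$d$ component. The cover ideal of $G$ is $J(G)=\bigcap_{\{u,v\}\in E(G)}(x_u,x_v)$, and its $t$-th symbolic power is $J(G)^{(t)}=\bigcap_{\{u,v\}\in E(G)}(x_u,x_v)^t$. For a nonzero homogeneous ideal $I$ of $S$ and an associated prime $P$ of $I$, the local $v$-number of $I$ at $P$ is $v_P(I)=\min\{d\ge 0 \mid \exists f\in S_d \text{ such that } I:f=P\}$. For an integer $t\ge1$, a vector $\mathbf a=(a_1,\dots,a_n)\in\mathbb N^n$ ($\mathbb N$ includes $0$) is a $t$-cover of $G$ if $a_u+a_v\ge t$ for every edge $\{u,v\}\in E(G)$. For an edge $P=\{i,j\}$, a $t$-cover $\mathbf a$ is $P$-tight if $a_i+a_j=t$. Write $|\mathbf b|=b_1+\dots+b_n$. Then $\gamma_{t,P}=\min\{|\mathbf b| \mid \mathbf b \text{ is a } P\text{-tight } t\text{-cover of } G\}$. *)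

(* Defs.v *)
From HB Require Import structures.
From mathcomp Require Import all_boot all_order all_algebra.
From mathcomp.multinomials Require Export mpoly.

Set Implicit Arguments.
Unset Strict Implicit.
Unset Printing Implicit Defensive.

Import GRing.Theory.
Local Open Scope ring_scope.

(* Ideals are Prop-valued predicates: membership is not assumed decidable, so
   the boolean [idealr] structure of ring_quotient does not apply. *)
Section IdealOperations.
Variable R : comNzRingType.
Implicit Types (A I J : R -> Prop) (f g : R).

Definition ideal_gen A f : Prop :=
  exists2 s : seq (R * R),
    (forall p, p \in s -> A p.2) & f = \sum_(p <- s) p.1 * p.2.

Definition ideal_mul I J : R -> Prop :=
  ideal_gen (fun h => exists f g, [/\ I f, J g & h = f * g]).

Definition ideal_pow I (t : nat) : R -> Prop :=
  iter t (ideal_mul I) (fun _ => True).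

Definition ideal_colon I f : R -> Prop := fun g => I (g * f).

Definition ideal_eq I J : Prop := forall f, I f <-> J f.

End IdealOperations.

Definition is_min (A : nat -> Prop) (m : nat) : Prop :=
  A m /\ (forall d, A d -> (m <= d)%N).

Lemma is_min_uniq (A : nat -> Prop) (m m' : nat) :
  is_min A m -> is_min A m' -> m = m'.
Proof.
move=> [Am lem] [Am' lem']; apply/eqP.
by rewrite eqn_leq lem // lem'.
Qed.

(* [is_local_v_number I P v] says that v_P(I) is defined and equal to v. *)
Definition is_local_v_number (k : fieldType) (n : nat)
    (I P : {mpoly k[n]} -> Prop) (v : nat) : Prop :=
  is_min (fun d => exists2 f : {mpoly k[n]},
            f \is d.-homog & ideal_eq (ideal_colon I f) P) v.

(* A simple graph on 'I_n is a symmetric irreflexive [e : rel 'I_n]. *)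
Section Graphs.
Variables (n : nat) (e : rel 'I_n).

Definition no_isolated_vertex : Prop := forall u, exists v, e u v.

Definition bipartite : Prop :=
  exists A : {set 'I_n}, forall u v, e u v -> (u \in A) != (v \in A).

Definition tcover (t : nat) (a : 'X_{1..n}) : Prop :=
  forall u v, e u v -> (t <= a u + a v)%N.

(* [is_gamma t i j m] says that m is gamma_{t,P} for the edge P = {i, j}. *)
Definition is_gamma (t : nat) (i j : 'I_n) (m : nat) : Prop :=
  is_min (fun d => exists b : 'X_{1..n},
            [/\ tcover t b, (b i + b j)%N = t & mdeg b = d]) m.

End Graphs.

Section CoverIdeals.
Variables (k : fieldType) (n : nat).

Definition edge_prime (u v : 'I_n) : {mpoly k[n]} -> Prop :=
  ideal_gen (fun f => f = 'X_u \/ f = 'X_v).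

Definition cover_ideal (e : rel 'I_n) (f : {mpoly k[n]}) : Prop :=
  forall u v, e u v -> edge_prime u v f.

Definition cover_symbolic_pow (e : rel 'I_n) (t : nat) (f : {mpoly k[n]})
    : Prop :=
  forall u v, e u v -> ideal_pow (edge_prime u v) t f.

End CoverIdeals.

Arguments edge_prime k {n} u v f.
Arguments cover_ideal k {n} e f.
Arguments cover_symbolic_pow k {n} e t f.

(* Main.v *)
(** Since [J(G)^(t)] is spanned by the monomials whose exponents are [t]-covers,
    [v_P(J(G)^(t))] is the least degree of an exponent [a] with
    [a_i + a_j = t - 1] and [a_u + a_v >= t] on every other edge.  Adding a
    [P]-tight 1-cover to such an [a] raises [t] by one; conversely, when [G] is
    bipartite and [t >= 2], a [P]-tight 1-cover can always be subtracted so that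
    [t] drops by one. *)
Require Import Defs.
From mathcomp Require Import all_boot all_order all_algebra.
From mathcomp Require Import zify.
From Stdlib Require Import Classical_Prop.

Set Implicit Arguments.
Unset Strict Implicit.
Unset Printing Implicit Defensive.

Import GRing.Theory.
Local Open Scope ring_scope.

(** [A] need not be decidable, so the descent to a smaller witness is decided by excluded middle. *)
Lemma is_min_ex (A : nat -> Prop) (d : nat) : A d -> exists m, is_min A m.
Proof.
elim/ltn_ind: d => d IHd Ad.
case: (classic (exists2 c, (c < d)%N & A c)) => [[c ltcd Ac]|no_less].
  exact: IHd ltcd Ac.
exists d; split=> // c Ac; rewrite leqNgt; apply/negP => ltcd.
by apply: no_less; exists c.
Qed.

Lemma is_min_ext (A B : nat -> Prop) (m : nat) :
  (forall d, A d <-> B d) -> is_min A m -> is_min B m.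
Proof.
by move=> AB [Am minA]; split=> [|d /AB]; [apply/AB | apply: minA].
Qed.

(** * Membership in edge primes and their powers, read off monomials *)

Section MonomialMembership.
Variables (k : fieldType) (n : nat).
Implicit Types (f g : {mpoly k[n]}) (m : 'X_{1..n}) (u v : 'I_n).

Definition edge_deg_ge u v (t : nat) f : Prop :=
  forall m, m \in msupp f -> (t <= m u + m v)%N.

Lemma edge_deg_geM u v s t f g :
  edge_deg_ge u v s f -> edge_deg_ge u v t g ->
  edge_deg_ge u v (s + t) (f * g).
Proof.
move=> fs gt m /msuppM_le /allpairsP[[m1 m2] /= [/fs le1 /gt le2 ->]].
by rewrite !mnmDE; lia.
Qed.

Lemma ideal_gen_edge_deg_ge u v t (A : {mpoly k[n]} -> Prop) f :
  (forall h, A h -> edge_deg_ge u v t h) -> ideal_gen A f ->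
  edge_deg_ge u v t f.
Proof.
move=> At [s sA ->]; elim: s sA => [|p s IHs] sA m.
  by rewrite big_nil msupp0.
rewrite big_cons => /msuppD_le; rewrite mem_cat => /orP[].
  have p2t := At _ (sA p (mem_head p s)).
  by apply: (@edge_deg_geM u v 0 t) p2t _.
by apply: IHs => q qs; apply: sA; rewrite inE qs orbT.
Qed.

Lemma ideal_gen_monomials (A : {mpoly k[n]} -> Prop) f :
  (forall m, m \in msupp f -> A 'X_[m]) -> ideal_gen A f.
Proof.
move=> Af; exists [seq ((f@_m)%:MP, 'X_[m]) | m <- msupp f].
  by move=> p /mapP[m /Af Am ->].
by rewrite big_map [LHS]mpolyE; apply: eq_bigr => m _ /=; rewrite mul_mpolyC.
Qed.

Lemma mpolyX_divX m u : (0 < m u)%N -> 'X_[k, m] = 'X_[m - U_(u)] * 'X_u.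
Proof.
move=> mu; rewrite -mpolyXD submK //; apply/mnm_lepP => v.
by rewrite mnm1E; case: eqP => [<-|].
Qed.

Lemma edge_primeP u v f : edge_prime k u v f <-> edge_deg_ge u v 1 f.
Proof.
split.
  apply: ideal_gen_edge_deg_ge => h [] -> m; rewrite msuppX inE => /eqP->;
    by rewrite !mnm1E eqxx; lia.
(* [w m] is a variable of the edge dividing ['X_[m]]; when [m u = 0], the bound in [f1] forces
   [m v > 0]. *)
pose w m := if (0 < m u)%N then u else v.
move=> f1; exists [seq ((f@_m)%:MP * 'X_[m - U_(w m)], 'X_(w m)) | m <- msupp f].
  by move=> p /mapP[m _ ->] /=; rewrite /w; case: ifP => _; [left|right].
rewrite big_map [LHS]mpolyE; apply: eq_big_seq => m mf /=.
rewrite -mulrA -mpolyX_divX ?mul_mpolyC //.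
by have := f1 m mf; rewrite /w; case: ifP => //; lia.
Qed.

(** Each monomial gives up one variable of the edge, which lowers its weight by one. If [u = v], the
    weight would count that exponent twice and drop by two. *)
Lemma edge_prime_powP u v t f : u != v ->
  ideal_pow (edge_prime k u v) t f <-> edge_deg_ge u v t f.
Proof.
move=> neq_uv; elim: t f => [|t IHt] f; first by split.
split=> [|ft].
  apply: ideal_gen_edge_deg_ge => _ [g [h [/edge_primeP g1 /IHt ht ->]]].
  exact: (edge_deg_geM g1 ht).
apply: ideal_gen_monomials => m mf.
have [w w_uv mw] : exists2 w, w = u \/ w = v & (0 < m w)%N.
  by case: (posnP (m u)) (ft m mf) => mu ft'; [exists v|exists u];
    [right| lia | left | ].
exists 'X_w, 'X_[m - U_(w)]; split; last by rewrite mulrC -mpolyX_divX.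
- apply/edge_primeP => m'; rewrite msuppX inE => /eqP->; rewrite !mnm1E.
  by case: w_uv => ->; rewrite eqxx; lia.
apply/IHt => m'; rewrite msuppX inE => /eqP->; rewrite !mnmBE !mnm1E.
have := ft m mf; case: w_uv mw => -> mw; rewrite eqxx.
  by rewrite (negPf neq_uv); lia.
by rewrite eq_sym (negPf neq_uv); lia.
Qed.

End MonomialMembership.

(** * Colon ideals equal to [P] and near-covers *)

Section LocalVNumber.
Variables (n : nat) (e : rel 'I_n) (i j : 'I_n).
Hypotheses (e_irr : irreflexive e) (e_ij : e i j).
Implicit Types (a b m : 'X_{1..n}).

Definition off_edge (u v : 'I_n) : bool := (u, v) \notin [:: (i, j); (j, i)].

Definition near_tcover (t : nat) a : Prop :=
  (a i + a j).+1 = t /\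
  (forall u v, e u v -> off_edge u v -> (t <= a u + a v)%N).

Lemma neq_edge u v : e u v -> u != v.
Proof. by apply: contraTneq => ->; rewrite e_irr. Qed.

Lemma off_edgePn u v : ~~ off_edge u v -> (u, v) = (i, j) \/ (u, v) = (j, i).
Proof. by rewrite negbK !inE => /orP[] /eqP; [left|right]. Qed.

Variant edge_spec (u v : 'I_n) : Prop :=
  | EdgeIJ of u = i & v = j
  | EdgeJI of u = j & v = i
  | EdgeOff of off_edge u v.

Lemma edgeP u v : edge_spec u v.
Proof.
case: (boolP (off_edge u v)) => [|/off_edgePn[[-> ->]|[-> ->]]];
  by [apply: EdgeOff | apply: EdgeIJ | apply: EdgeJI].
Qed.

(** Only the edge [P] fails for [a], and it fails by one, so any positive weight of [m] on [P]
    repairs it. *)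
Lemma near_tcoverD t a m : near_tcover t a ->
  tcover e t (m + a)%MM <-> (0 < m i + m j)%N.
Proof.
move=> [a_ij a_off]; split=> [/(_ i j e_ij)|m_ij u v e_uv].
  by rewrite !mnmDE; lia.
rewrite !mnmDE; case: (edgeP u v) => [-> ->|-> ->|off]; try lia.
by have := a_off u v e_uv off; lia.
Qed.

(** An edge other than [P] misses [i] or [j], so one of the two shifts leaves its weight
    unchanged. *)
Lemma near_tcover_of_shifts t a : (a i + a j < t)%N ->
  tcover e t (U_(i) + a)%MM -> tcover e t (U_(j) + a)%MM -> near_tcover t a.
Proof.
move=> lt_t cov_i cov_j; have neq_ij := neq_edge e_ij.
split=> [|u v e_uv off].
  have := cov_i i j e_ij; rewrite !mnmDE !mnm1E eqxx (negPf neq_ij); lia.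
have := cov_i u v e_uv; have := cov_j u v e_uv; have := neq_edge e_uv.
move: off neq_ij; rewrite /off_edge !mnmDE !mnm1E !inE !xpair_eqE.
by rewrite -!val_eqE /=; lia.
Qed.

(** A near-cover [a] is realized by ['X_[a]]. Conversely, if [f] has colon [P], then any monomial of
    [f] of weight below [t] on [P] is a near-cover, because ['X_i * f] and ['X_j * f] lie in [I]. *)
Lemma colon_eq_edge_primeP (k : fieldType) (I : {mpoly k[n]} -> Prop) t d :
    (forall f, I f <-> forall m, m \in msupp f -> tcover e t m) ->
  (exists2 f : {mpoly k[n]},
     f \is d.-homog & ideal_eq (ideal_colon I f) (edge_prime k i j)) <->
  (exists2 a, near_tcover t a & mdeg a = d).
Proof.
move=> IP; split=> [[f f_hom fP]|[a a_near <-]]; last first.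
  exists 'X_[a]; first by rewrite dhomogX.
  move=> g; rewrite /ideal_colon IP edge_primeP; split=> gP m mg.
    apply/(near_tcoverD _ a_near)/gP.
    by rewrite addmC (perm_mem (msuppMX _ _)) map_f.
  move: mg; rewrite (perm_mem (msuppMX _ _)) => /mapP[m' m'g ->].
  by rewrite addmC; apply/(near_tcoverD _ a_near)/gP.
have shift_cov w a : w = i \/ w = j -> a \in msupp f ->
    tcover e t (U_(w) + a)%MM.
  move=> w_ij af; have /fP: edge_prime k i j 'X_w.
    apply/edge_primeP => m; rewrite msuppX inE => /eqP->; rewrite !mnm1E.
    by case: w_ij => ->; rewrite eqxx; lia.
  move=> /IP; apply; rewrite mulrC (perm_mem (msuppMX _ _)).
  by rewrite map_f.
have [a af lt_t] : exists2 a, a \in msupp f & (a i + a j < t)%N.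
  apply/hasP; apply: contraT => /hasPn f_ge.
  (* Multiplying by [x_u ^ t] for all [u] off [P] forces every edge but [P]. *)
  pose c := [multinom (if (u == i) || (u == j) then 0 else t)%N | u < n].
  have /fP/edge_primeP/(_ c) : ideal_colon I f 'X_[c].
    apply/IP => m; rewrite mulrC (perm_mem (msuppMX _ _)) => /mapP[m' m'f ->].
    move=> u v e_uv; rewrite !mnmDE !mnmE.
    have := f_ge m' m'f; rewrite -leqNgt => m'_ij.
    case: ifP => [|_]; last lia.
    case: ifP => [|_ _]; last lia.
    move=> /orP[/eqP v_|/eqP v_] /orP[/eqP u_|/eqP u_]; subst u v; try lia.
      by rewrite e_irr in e_uv.
    by rewrite e_irr in e_uv.
  (* [c] vanishes at [i] and [j], so ['X_[c]] is not in [P]: a contradiction. *)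
  by rewrite msuppX inE !mnmE !eqxx orbT; move/(_ isT).
exists a; last by rewrite (dhomog_mf f_hom af).
by apply: near_tcover_of_shifts => //; apply: shift_cov => //; [left|right].
Qed.

Lemma local_v_numberP (k : fieldType) (I : {mpoly k[n]} -> Prop) t d :
    (forall f, I f <-> forall m, m \in msupp f -> tcover e t m) ->
  is_min (fun c => exists2 a, near_tcover t a & mdeg a = c) d ->
  is_local_v_number I (edge_prime k i j) d.
Proof.
by move=> IP; apply: is_min_ext => c; apply: iff_sym; apply: colon_eq_edge_primeP.
Qed.

(** * Raising and lowering the level of a near-cover *)

Lemma near_tcover_add t s a b :
    near_tcover t a -> tcover e 1 b -> (b i + b j = 1)%N ->
  near_tcover (t + s) (a + b *+ s)%MM.
Proof.
move=> [a_ij a_off] b_cov b_ij; split=> [|u v e_uv off].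
  by rewrite !mnmDE !mulmnE; nia.
have := a_off u v e_uv off; have := b_cov u v e_uv.
by rewrite !mnmDE !mulmnE; nia.
Qed.

Lemma near_tcover_sub t a : bipartite e -> near_tcover t.+2 a ->
  exists b, [/\ tcover e 1 b, (b i + b j = 1)%N, (b <= a)%MM
              & near_tcover t.+1 (a - b)%MM].
Proof.
move=> [A A_bip] [a_ij a_off].
(* At level [t.+2] the weight of [a] on [P] is [t.+1], hence positive. *)
have [x x_ij ax] : exists2 x, x = i \/ x = j & (0 < a x)%N.
  by case: (posnP (a i)) => ai; [exists j|exists i]; [right| lia | left | ].
(* Support on the side of [x], truncation at level [t.+2] on the other side. *)
pose b := [multinom ((if (u \in A) == (x \in A) then 0 < a u
                      else t.+2 <= a u) : nat)%N | u < n].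
have bE u : b u = (if (u \in A) == (x \in A) then 0 < a u else t.+2 <= a u)%N.
  by rewrite mnmE.
(* [b x = 1], while the other end of [P] has exponent at most [t], below the truncation level. *)
have b_ij : (b i + b j = 1)%N.
  have := A_bip i j e_ij; rewrite !bE.
  case: x_ij ax => -> ax; rewrite eqxx; [rewrite eq_sym|] => /negPf->; lia.
(* If the end on the side of [x] has exponent 0, the other end reaches [t.+2], so [b] covers the
   edge. If [b] takes one from both ends, the end at level [t.+2] alone still leaves [t.+1]. *)
have b_off u v : e u v -> off_edge u v ->
    (0 < b u + b v)%N && (t.+1 <= (a u - b u) + (a v - b v))%N.
  move=> e_uv off; have := a_off u v e_uv off; have := A_bip u v e_uv.
  by rewrite !bE; case: (u \in A) (v \in A) (x \in A) => [] [] [] //= _; lia.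
exists b; split=> //.
- move=> u v e_uv; case: (edgeP u v) => [-> ->|-> ->|off]; try lia.
  by case/andP: (b_off u v e_uv off).
- by apply/mnm_lepP => u; rewrite bE; case: ifP => _; lia.
split=> [|u v e_uv off]; last first.
  by rewrite !mnmBE; case/andP: (b_off u v e_uv off).
(* Since [b <= a], the subtraction of naturals is exact on [P]. *)
have b_le u : (b u <= a u)%N by rewrite bE; case: ifP => _; lia.
by have := b_le i; have := b_le j; rewrite !mnmBE; lia.
Qed.

(** Peeling off [t] tight 1-covers, each of degree at least [g], leaves a near-cover of level 1. *)
Lemma near_tcover_deg_ge v1 g t a : bipartite e ->
    (forall a', near_tcover 1 a' -> (v1 <= mdeg a')%N) ->
    (forall b, tcover e 1 b -> (b i + b j = 1)%N -> (g <= mdeg b)%N) ->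
  near_tcover t.+1 a -> (v1 + t * g <= mdeg a)%N.
Proof.
move=> bip min_v1 min_g; elim: t a => [|t IHt] a a_near.
  by rewrite mul0n addn0; apply: min_v1.
have [b [b_cov b_ij b_le ab_near]] := near_tcover_sub bip a_near.
have := min_g b b_cov b_ij; have := IHt _ ab_near.
by rewrite -(submK b_le) mdegD addmK; lia.
Qed.

Lemma near_1cover_ex : exists a, near_tcover 1 a.
Proof.
(* Every edge other than [P] has an end outside [P]. *)
exists [multinom (~~ ((u == i) || (u == j)) : nat) | u < n].
split=> [|u v e_uv off]; first by rewrite !mnmE !eqxx orbT.
have := neq_edge e_uv; move: off; rewrite /off_edge !mnmE !inE !xpair_eqE.
by rewrite -!val_eqE /=; lia.
Qed.

(** One side of the bipartition contains exactly one end of each edge. *)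
Lemma tight_1cover_ex : bipartite e ->
  exists2 b, tcover e 1 b & (b i + b j = 1)%N.
Proof.
move=> [A A_bip]; exists [multinom (u \in A : nat) | u < n] => [u v e_uv|].
  by have := A_bip u v e_uv; rewrite !mnmE; do 2 case: (_ \in A).
by have := A_bip i j e_ij; rewrite !mnmE; do 2 case: (_ \in A).
Qed.

End LocalVNumber.

(** * Cover ideals and the final formula *)

Lemma cover_symbolic_powP (k : fieldType) n (e : rel 'I_n) t
    (f : {mpoly k[n]}) : irreflexive e ->
  cover_symbolic_pow k e t f <-> forall m, m \in msupp f -> tcover e t m.
Proof.
move=> e_irr; split=> [ft m mf u v e_uv|ft u v e_uv].
  exact: (edge_prime_powP t f (neq_edge e_irr e_uv)).1 (ft u v e_uv) m mf.
by apply/(edge_prime_powP t f (neq_edge e_irr e_uv)) => m /ft; apply.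
Qed.

Lemma cover_idealP (k : fieldType) n (e : rel 'I_n) (f : {mpoly k[n]}) :
  cover_ideal k e f <-> forall m, m \in msupp f -> tcover e 1 m.
Proof.
split=> [f1 m mf u v e_uv|f1 u v e_uv].
  exact: (edge_primeP u v f).1 (f1 u v e_uv) m mf.
by apply/edge_primeP => m /f1; apply.
Qed.

Theorem theorem1p3 (k : fieldType) (n : nat) (e : rel 'I_n)
    (e_sym : symmetric e) (e_irr : irreflexive e)
    (e_bip : bipartite e) (e_noiso : no_isolated_vertex e)
    (i j : 'I_n) (e_ij : e i j) (t : nat) (t_ge1 : (1 <= t)%N) :
  exists vt v1 g : nat,
    [/\ is_local_v_number (cover_symbolic_pow k e t) (edge_prime k i j) vt,
        is_local_v_number (cover_ideal k e) (edge_prime k i j) v1,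
        is_gamma e 1 i j g
      & vt = (v1 + (t - 1) * g)%N].
Proof.
have [a0 a0_near] := near_1cover_ex e_irr e_ij.
have [v1 v1_min] : exists d,
    is_min (fun c => exists2 a, near_tcover e i j 1 a & mdeg a = c) d.
  by apply: (@is_min_ex _ (mdeg a0)); exists a0.
have [b0 b0_cov b0_ij] := tight_1cover_ex e_ij e_bip.
have [g g_min] : exists g, is_gamma e 1 i j g.
  by apply: (@is_min_ex _ (mdeg b0)); exists b0.
exists (v1 + (t - 1) * g)%N, v1, g; split=> //.
  apply: (local_v_numberP e_irr e_ij) => [f|]; first exact: cover_symbolic_powP.
  case: v1_min g_min => [[a a_near a_deg] min_v1] [[b [b_cov b_ij b_deg]] min_g].
  split=> [|_ [c c_near <-]].
    (* The value is attained by adding [t - 1] copies of a minimal tight 1-cover to a minimal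
       near-cover of level 1. *)
    exists (a + b *+ (t - 1))%MM; last by rewrite mdegD mdegMn a_deg b_deg mulnC.
    by rewrite -{1}(subnKC t_ge1); apply: near_tcover_add.
  apply: (near_tcover_deg_ge e_ij e_bip) => [a' a'_near|b' b'_cov b'_ij|].
  - by apply: min_v1; exists a'.
  - by apply: min_g; exists b'.
  by rewrite subn1 prednK.
by apply: (local_v_numberP e_irr e_ij _ v1_min) => f; apply: cover_idealP.
Qed.
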